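(* Let $a,b,c$ be real numbers, let $\epsilon_{i,j}$, $i,j\in\mathbb{Z}$, be uncorrelated random variables with zero mean and equal variance $\sigma_\epsilon^2\in(0,\infty)$, and let $X=\{X_{i,j},\ i,j\in\mathbb{Z}\}$ be a wide-sense stationary field satisfying $$X_{i,j}=aX_{i-1,j}+bX_{i,j-1}+cX_{i-1,j-1}+\epsilon_{i,j}\qquad\text{for all } i,j\in\mathbb{Z}.$$ Then $X$ is centered (i.e. $\mathsf{E}X_{i,j}=0$ for all $i,j$) and has the spectral density $$f_X(\nu_1,\nu_2)=\frac{\sigma_\epsilon^2}{|1-ae^{2\pi\mathrm{i}\nu_1}-be^{2\pi\mathrm{i}\nu_2}-ce^{2\pi\mathrm{i}(\nu_1+\nu_2)}|^2}.$$
   Context: All random variables are real-valued. A random field is wide-sense stationary if it has finite second moments, constant mean, and $\operatorname{cov}(X_{i,j},X_{i-h_1,j-h_2})$ depends only on $(h_1,h_2)$. An integrable function $f_X$ on $[-\frac12,\frac12]^2$ is a spectral density of a wide-sense stationary field $X$ if for all integers $h_1,h_2$ $$\operatorname{cov}(X_{i,j},X_{i-h_1,j-h_2})=\int_{-1/2}^{1/2}\int_{-1/2}^{1/2}\exp(2\pi\mathrm{i}(h_1\nu_1+h_2\nu_2))f_X(\nu_1,\nu_2)\,d\nu_1\,d\nu_2 .$$ *)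

(* Defs.v *)
From HB Require Import structures.
From mathcomp Require Import all_boot all_order all_algebra.
From mathcomp Require Import all_classical all_reals all_analysis.
From mathcomp Require Import complex.

Set Implicit Arguments.
Unset Strict Implicit.
Unset Printing Implicit Defensive.

Import Order.TTheory GRing.Theory Num.Theory.
Import numFieldNormedType.Exports.

Local Open Scope classical_set_scope.
Local Open Scope ring_scope.
Local Open Scope complex_scope.

(* exp(i t) for real t *)
Definition expi (R : realType) (t : R) : R[i] := cos t +i* sin t.

(* The libraries have no integral of complex-valued functions: real and
   imaginary parts are integrated separately.  As with [Rintegral], the value
   is meaningful when both parts are integrable. *)
Definition Cintegral (d : measure_display) (T : measurableType d)
    (R : realType) (mu : {measure set T -> \bar R}) (D : set T)
    (g : T -> R[i]) : R[i] :=
  Rintegral mu D (fun x => complex.Re (g x)) +i*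
  Rintegral mu D (fun x => complex.Im (g x)).

Definition freq_square (R : realType) : set (R * R) :=
  `[- (1 / 2), 1 / 2]%classic `*` `[- (1 / 2), 1 / 2]%classic.

Definition lebesgue2 (R : realType) :
    {measure set (measurableTypeR R * measurableTypeR R) -> \bar R} :=
  (@lebesgue_measure R \x @lebesgue_measure R)%E.

Section fields.
Context (d : measure_display) (T : measurableType d) (R : realType).
Context (P : probability T R).

Definition wide_sense_stationary (X : int -> int -> {RV P >-> R}) : Prop :=
  [/\ forall i j : int, (X i j : T -> R) \in Lfun P 2%:E,
      forall i j i' j' : int, 'E_P[X i j]%E = 'E_P[X i' j']%E
    & forall i j i' j' h1 h2 : int,
        covariance P (X i j) (X (i - h1) (j - h2)) =
        covariance P (X i' j') (X (i' - h1) (j' - h2)) ].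

(* Zero mean, pairwise uncorrelated, common variance [s2]. *)
Definition white_noise (s2 : R) (eps : int -> int -> {RV P >-> R}) : Prop :=
  [/\ forall i j : int, (eps i j : T -> R) \in Lfun P 2%:E,
      forall i j : int, 'E_P[eps i j]%E = 0%E,
      forall i j : int, 'V_P[eps i j]%E = s2%:E
    & forall i j i' j' : int, (i, j) != (i', j') ->
        covariance P (eps i j) (eps i' j') = 0%E ].

(* [fine] loses nothing here: the covariances of a wide-sense stationary field
   are finite. *)
Definition is_spectral_density (X : int -> int -> {RV P >-> R})
    (f : R * R -> R) : Prop :=
  (lebesgue2 R).-integrable (@freq_square R) (EFin \o f) /\
  forall i j h1 h2 : int,
    (fine (covariance P (X i j) (X (i - h1) (j - h2))))%:C =
    Cintegral (lebesgue2 R) (@freq_square R)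
      (fun nu => expi (2 * pi * (h1%:~R * nu.1 + h2%:~R * nu.2)) * (f nu)%:C).

End fields.

(* Main.v *)
Require Import Defs.
From HB Require Import structures.
From mathcomp Require Import all_boot all_order all_algebra.
From mathcomp Require Import all_classical all_reals all_analysis.
From mathcomp Require Import measurable_realfun complex.
From mathcomp Require Import ring lra zify.

(** Write [e(x) = exp (2 pi i x)], let
  [P(nu) = 1 - a e(nu1) - b e(nu2) - c e(nu1 + nu2)] and let [P(S)] be the
  corresponding shift operator, so that [P(S) X = eps].

  The cross-covariance [psi k = cov(X_k, eps_0)] satisfies
  [P(S) psi = sigma^2 delta] and is square summable by Bessel's inequality.
  This excludes zeros of [P] on the torus: if [P(nu) = 0], pair the equation
  with the wave [cos (k.nu)] cut off by a tent which is 1 on the box of radius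
  [N] and 0 outside the box of radius [2N].  In dimension two the image of this
  test function under the adjoint of [P(S)] has bounded l2 norm, and it vanishes
  inside the box of radius [N], so the l2 mass of [psi] between the radii [N] and
  [2N] would be bounded below.

  Hence [|P|^2 >= m > 0] by compactness.  Both the autocovariance and the Fourier
  coefficients of [sigma^2 / |P|^2] are bounded solutions of
  [|P|^2(S) u = sigma^2 delta], so it remains to see that a bounded [u] with
  [|P|^2(S) u = 0] vanishes.  Such a [u] is fixed by an operator [T(S)] whose
  symbol satisfies [0 <= T <= rho < 1].  The coefficients of [T^n] are bounded
  by [rho^n] and at most [(2n+1)^2] of them are nonzero, so [u = T(S)^n u] is
  [O(n^2 rho^n)]. *)

Import Order.TTheory GRing.Theory Num.Theory.
Import numFieldNormedType.Exports.

Local Open Scope classical_set_scope.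
Local Open Scope ring_scope.
Local Open Scope complex_scope.

Set Implicit Arguments.
Unset Strict Implicit.
Unset Printing Implicit Defensive.

(** * Sums over boxes and stencils *)

(** Listed from the centre outwards, so that raising the radius only prepends two terms; the
    inductions on the radius rest on this. *)
Fixpoint zball (n : nat) : seq int :=
  if n is m.+1 then m.+1%:Z :: - m.+1%:Z :: zball m else [:: 0].

Lemma mem_zball n i : (i \in zball n) = (`|i| <= n)%N.
Proof.
elim: n => [|n IHn]; first by rewrite inE; apply/eqP/idP; lia.
rewrite !inE IHn; apply/orP/idP => [[/eqP ->|/orP[/eqP ->|]]|]; lia.
Qed.

Lemma zball_uniq n : uniq (zball n).
Proof.
elim: n => [//|n IHn]; rewrite /= !inE !mem_zball IHn andbT; apply/andP; split.
  by rewrite negb_or; apply/andP; split; [apply/eqP; lia|lia].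
by lia.
Qed.

Lemma size_zball n : size (zball n) = n.*2.+1.
Proof. by elim: n => //= n ->. Qed.

(** * Sums over square boxes and their translates *)

Section box.
Context {V : comNzRingType}.

Lemma zball_sumS n (F : int -> V) : \sum_(i <- zball n.+1) F i =
  F n.+1%:Z + F (- n.+1%:Z) + \sum_(i <- zball n) F i.
Proof. by rewrite /= !big_cons addrA. Qed.

Lemma zball_trunc (n N : nat) (F : int -> V) : (n <= N)%N ->
  (forall i, (n < `|i|)%N -> F i = 0) ->
  \sum_(i <- zball N) F i = \sum_(i <- zball n) F i.
Proof.
elim: N => [|N IHN] nN F0; first by move: nN; rewrite leqn0 => /eqP ->.
move: nN; rewrite leq_eqVlt => /predU1P[-> //|nN].
by rewrite zball_sumS !F0 ?IHN ?addr0 ?add0r//; lia.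
Qed.

Lemma zball_shift1 n (F : int -> V) :
  \sum_(i <- zball n) F (i + 1) =
  \sum_(i <- zball n) F i - F (- n%:Z) + F (n%:Z + 1).
Proof.
elim: n => [|n IHn]; first by rewrite !big_seq1 subrr !add0r.
rewrite !zball_sumS IHn.
have -> : - n.+1%:Z + 1 = - n%:Z by lia.
have -> : n%:Z + 1 = n.+1%:Z by lia.
by ring.
Qed.

(** A unit shift changes the sum only by end terms, taken at points of absolute value [n] or
    [n + 1], where [F] vanishes. *)
Lemma zball_shift n (F : int -> V) (m : int) : (`|m| <= 1)%N ->
  (forall i, (n <= `|i|)%N -> F i = 0) ->
  \sum_(i <- zball n) F (i + m) = \sum_(i <- zball n) F i.
Proof.
move=> m1 F0; have : m = 0 \/ m = 1 \/ m = -1 by lia.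
case=> [->|[->|->]].
- by apply: eq_bigr => i _; rewrite addr0.
- by rewrite zball_shift1 !F0 ?subr0 ?addr0//; lia.
- transitivity (\sum_(i <- zball n) F (i + 1 - 1)); last first.
    by apply: eq_bigr => i _; rewrite addrK.
  rewrite (zball_shift1 n (fun i => F (i - 1))) (F0 (_ - _)); last by lia.
  have -> : n%:Z + 1 - 1 = n%:Z by lia.
  by rewrite F0 ?subr0 ?addr0//; lia.
Qed.

Definition box_sum n (F : int -> int -> V) : V :=
  \sum_(i <- zball n) \sum_(j <- zball n) F i j.

Lemma box_trunc (n N : nat) (F : int -> int -> V) : (n <= N)%N ->
  (forall i j, (n < `|i|)%N || (n < `|j|)%N -> F i j = 0) ->
  box_sum N F = box_sum n F.
Proof.
move=> nN F0; rewrite /box_sum (zball_trunc nN); last first.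
  by move=> i ni; apply: big1 => j _; rewrite F0 // ni.
by apply: eq_bigr => i _; apply: zball_trunc => // j nj; rewrite F0 // nj orbT.
Qed.

Lemma box_shift n (F : int -> int -> V) (m1 m2 : int) :
  (`|m1| <= 1)%N -> (`|m2| <= 1)%N ->
  (forall i j, (n <= `|i|)%N || (n <= `|j|)%N -> F i j = 0) ->
  box_sum n (fun i j => F (i + m1) (j + m2)) = box_sum n F.
Proof.
move=> hm1 hm2 F0; rewrite /box_sum.
transitivity (\sum_(i <- zball n) \sum_(j <- zball n) F (i + m1) j).
  apply: eq_bigr => i _; apply: zball_shift => // j nj.
  by rewrite F0 // nj orbT.
apply: (zball_shift (F := fun i => \sum_(j <- zball n) F i j)) => // i ni.
by apply: big1 => j _; rewrite F0 // ni.
Qed.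

Lemma eq_box n (F G : int -> int -> V) : (forall i j, F i j = G i j) ->
  box_sum n F = box_sum n G.
Proof. by move=> FG; apply: eq_bigr => i _; apply: eq_bigr => j _. Qed.

Lemma box_exchange (I : Type) (s : seq I) n (F : I -> int -> int -> V) :
  box_sum n (fun i j => \sum_(t <- s) F t i j) =
  \sum_(t <- s) box_sum n (F t).
Proof.
rewrite /box_sum [RHS]exchange_big /=; apply: eq_bigr => i _.
by rewrite exchange_big.
Qed.

Lemma box_sumD n (F G : int -> int -> V) :
  box_sum n (fun i j => F i j + G i j) = box_sum n F + box_sum n G.
Proof.
rewrite /box_sum -big_split; apply: eq_bigr => i _ /=.
by rewrite -big_split.
Qed.

End box.

(** * Shift-invariant operators of finite range *)

Section stencil.
Context {R : comNzRingType}.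
Implicit Types (s : seq (R * (int * int))) (u : int -> int -> R).

(* A stencil is a list of pairs (coefficient, shift); it stands for the operator
   [u |-> sum c * u (. + m)]. *)
Definition sapply s u (i j : int) : R :=
  \sum_(t <- s) t.1 * u (i + t.2.1) (j + t.2.2).

(** The coefficients are real, so reflecting the shifts gives the adjoint; the symbol becomes its
    conjugate. *)
Definition sadj s := [seq (t.1, (- t.2.1, - t.2.2)) | t <- s].

Definition scomp s s' :=
  [seq (t.1 * t'.1, (t.2.1 + t'.2.1, t.2.2 + t'.2.2)) | t <- s, t' <- s'].

Definition unit_range s := all (fun t => (`|t.2.1| <= 1)%N && (`|t.2.2| <= 1)%N) s.

Lemma box_sumZ n (c : R) (F : int -> int -> R) :
  box_sum n (fun i j => c * F i j) = c * box_sum n F.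
Proof.
rewrite /box_sum mulr_sumr; apply: eq_bigr => i _.
by rewrite mulr_sumr.
Qed.

Lemma sapply_comp s s' u i j :
  sapply (scomp s s') u i j = sapply s (sapply s' u) i j.
Proof.
rewrite /sapply /scomp big_allpairs_dep; apply: eq_bigr => t _ /=.
rewrite mulr_sumr; apply: eq_bigr => t' _ /=.
by rewrite !addrA mulrA.
Qed.

Lemma eq_sapply s u v : (forall i j, u i j = v i j) ->
  forall i j, sapply s u i j = sapply s v i j.
Proof. by move=> uv i j; apply: eq_bigr => t _; rewrite uv. Qed.

Lemma sapplyB s u v i j : sapply s (fun i j => u i j - v i j) i j =
  sapply s u i j - sapply s v i j.
Proof.
by rewrite /sapply -sumrB; apply: eq_bigr => t _; rewrite mulrBr.
Qed.

(** Summation by parts: [h] vanishes from radius [n] on, so its unit translates vanish from radius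
    [n + 1] on and no boundary term appears. *)
Lemma sapply_adjoint s n (h psi : int -> int -> R) : unit_range s ->
  (forall i j, (n <= `|i|)%N || (n <= `|j|)%N -> h i j = 0) ->
  box_sum n.+1 (fun i j => h i j * sapply s psi i j) =
  box_sum n.+1 (fun i j => psi i j * sapply (sadj s) h i j).
Proof.
move=> /allP s1 h0.
transitivity (\sum_(t <- s)
    box_sum n.+1 (fun i j => t.1 * (h i j * psi (i + t.2.1) (j + t.2.2)))).
  rewrite -box_exchange; apply: eq_box => i j.
  by rewrite mulr_sumr; apply: eq_bigr => t _; rewrite mulrCA.
rewrite [RHS](_ : _ = \sum_(t <- s) box_sum n.+1 (fun i j =>
   t.1 * (h (i - t.2.1) (j - t.2.2) * psi i j))); last first.
  rewrite -box_exchange; apply: eq_box => i j.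
  rewrite /sapply big_map mulr_sumr; apply: eq_bigr => t _ /=.
  by rewrite mulrCA [psi _ _ * _]mulrC.
rewrite big_seq [RHS]big_seq; apply: eq_bigr => t /s1 /andP[t1 t2].
rewrite !box_sumZ; congr *%R.
rewrite -(@box_shift _ _
   (fun i j => h (i - t.2.1) (j - t.2.2) * psi i j) t.2.1 t.2.2)//.
  by apply: eq_box => i j; rewrite !addrK.
move=> i j nij; rewrite h0 ?mul0r//.
by case: t t1 t2 => c [m1 m2] /= t1 t2; lia.
Qed.

End stencil.

Section box_real.
Context {R : realDomainType}.

Lemma ler_box n (F G : int -> int -> R) :
  (forall i j, (`|i| <= n)%N -> (`|j| <= n)%N -> F i j <= G i j) ->
  box_sum n F <= box_sum n G.
Proof.
move=> FG; rewrite /box_sum big_seq [leRHS]big_seq; apply: ler_sum => i.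
rewrite mem_zball => ni; rewrite big_seq [leRHS]big_seq; apply: ler_sum => j.
by rewrite mem_zball => nj; exact: FG.
Qed.

Lemma ler_norm_box n (F : int -> int -> R) :
  `|box_sum n F| <= box_sum n (fun i j => `|F i j|).
Proof.
rewrite /box_sum (le_trans (ler_norm_sum _ _ _))//; apply: ler_sum => i _.
exact: ler_norm_sum.
Qed.

Lemma box_cst n (c : R) :
  box_sum n (fun _ _ => c) = n.*2.+1%:R ^+ 2 * c.
Proof.
rewrite /box_sum !big_const_seq !count_predT !iter_addr_0 size_zball.
by rewrite -mulrnA -[LHS]mulr_natl natrM expr2.
Qed.

End box_real.

(** * Symbols, and nonvanishing for square summable responses *)

Section symbol.
Context {R : realType}.
Implicit Types (s : seq (R * (int * int))) (x y : R).

Definition phase x y (i j : int) : R := x * i%:~R + y * j%:~R.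

(* Real and imaginary parts of the symbol [sum c * exp (i m.(x, y))]. *)
Definition csym s x y : R := \sum_(t <- s) t.1 * cos (phase x y t.2.1 t.2.2).
Definition ssym s x y : R := \sum_(t <- s) t.1 * sin (phase x y t.2.1 t.2.2).

Lemma phaseD x y i j i' j' :
  phase x y (i + i') (j + j') = phase x y i j + phase x y i' j'.
Proof. by rewrite /phase !intrD !mulrDr addrACA. Qed.

Lemma phaseN x y i j : phase x y (- i) (- j) = - phase x y i j.
Proof. by rewrite /phase !intrN !mulrN -opprD. Qed.

(** Real part of the fact that a plane wave is an eigenvector of every stencil, with the symbol as
    eigenvalue. *)
Lemma sapply_cos s (th x y : R) i j :
  sapply s (fun i j => cos (th + phase x y i j)) i j =
  cos (th + phase x y i j) * csym s x y - sin (th + phase x y i j) * ssym s x y.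
Proof.
rewrite /sapply /csym /ssym !mulr_sumr -sumrB; apply: eq_bigr => t _.
by rewrite phaseD addrA [X in _ * X = _]cosD; ring.
Qed.

Lemma csym_adj s x y : csym (sadj s) x y = csym s x y.
Proof.
by rewrite /csym big_map; apply: eq_bigr => t _ /=; rewrite phaseN cosN.
Qed.

Lemma ssym_adj s x y : ssym (sadj s) x y = - ssym s x y.
Proof.
rewrite /ssym big_map -sumrN; apply: eq_bigr => t _ /=.
by rewrite phaseN sinN mulrN.
Qed.

Lemma csym_comp s s' x y :
  csym (scomp s s') x y = csym s x y * csym s' x y - ssym s x y * ssym s' x y.
Proof.
rewrite /csym /ssym big_allpairs_dep /= !mulr_suml -sumrB.
apply: eq_bigr => t _; rewrite !mulr_sumr -sumrB; apply: eq_bigr => t' _ /=.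
by rewrite phaseD cosD; ring.
Qed.

Lemma ssym_comp s s' x y :
  ssym (scomp s s') x y = ssym s x y * csym s' x y + csym s x y * ssym s' x y.
Proof.
rewrite /csym /ssym big_allpairs_dep /= !mulr_suml -big_split.
apply: eq_bigr => t _ /=; rewrite !mulr_sumr -big_split; apply: eq_bigr => t' _ /=.
by rewrite phaseD sinD; ring.
Qed.

(** For positive [N], in the sup norm: [1] up to radius [N], then linear down to [0] at radius
    [2 * N]. The inner [maxn N] makes the plateau, truncated subtraction the zero tail. *)
Definition tent (N : nat) (i j : int) : R :=
  (2 * N - maxn N (maxn `|i| `|j|))%:R / N%:R.

Lemma tent_far N i j : (2 * N <= `|i|)%N || (2 * N <= `|j|)%N -> tent N i j = 0.
Proof.
move=> h; rewrite /tent (_ : (_ - _)%N = 0%N) ?mul0r//; lia.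
Qed.

Lemma tent_near N i j : (0 < N)%N -> (`|i| <= N)%N -> (`|j| <= N)%N ->
  tent N i j = 1.
Proof.
move=> N0 iN jN; rewrite /tent (_ : (_ - _)%N = N); last by lia.
by rewrite divff// pnatr_eq0; lia.
Qed.

Lemma tent_lipschitz N i j (m1 m2 : int) : (0 < N)%N ->
  (`|m1| <= 1)%N -> (`|m2| <= 1)%N ->
  `|tent N (i + m1) (j + m2) - tent N i j| <= N%:R^-1.
Proof.
move=> N0 hm1 hm2; rewrite /tent -mulrBl normrM [`|_^-1|]ger0_norm ?invr_ge0//.
rewrite ler_piMl ?invr_ge0// ler_norml.
set p := (X in X%:R - _); set q := (X in _ - X%:R).
have pq : (p <= q.+1)%N by rewrite /p /q; lia.
have qp : (q <= p.+1)%N by rewrite /p /q; lia.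
move: pq qp; rewrite -!(ler_nat R) -!natr1; clear; lra.
Qed.

Definition tent_wave x y N (i j : int) : R := tent N i j * cos (phase x y i j).

(** At a zero of the symbol the adjoint annihilates the uncut wave; subtracting [tent N i j] times
    this zero leaves only increments of the tent. *)
Lemma sadj_tent_wave s x y N i j : csym s x y = 0 -> ssym s x y = 0 ->
  sapply (sadj s) (tent_wave x y N) i j =
  \sum_(t <- s) t.1 * ((tent N (i - t.2.1) (j - t.2.2) - tent N i j) *
                       cos (phase x y (i - t.2.1) (j - t.2.2))).
Proof.
move=> c0 s0.
have h0 : sapply (sadj s) (fun i j => cos (0 + phase x y i j)) i j = 0.
  by rewrite sapply_cos csym_adj ssym_adj c0 s0 oppr0 !mulr0 subr0.
transitivity (sapply (sadj s) (tent_wave x y N) i j - tent N i j *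
    sapply (sadj s) (fun i j => cos (0 + phase x y i j)) i j).
  by rewrite h0 mulr0 subr0.
rewrite /sapply !big_map mulr_sumr -sumrB.
apply: eq_bigr => t _ /=; rewrite /tent_wave add0r; ring.
Qed.

Definition sweight s : R := \sum_(t <- s) `|t.1|.

Lemma sadj_tent_wave_le s x y N i j : unit_range s -> (0 < N)%N ->
  csym s x y = 0 -> ssym s x y = 0 ->
  `|sapply (sadj s) (tent_wave x y N) i j| <= sweight s / N%:R.
Proof.
move=> /allP s1 N0 c0 s0; rewrite sadj_tent_wave//.
rewrite (le_trans (ler_norm_sum _ _ _))// /sweight mulr_suml.
rewrite big_seq [leRHS]big_seq; apply: ler_sum => t /s1 /andP[t1 t2].
rewrite !normrM ler_wpM2l// -[leRHS]mulr1 ler_pM//.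
  by apply: tent_lipschitz => //; rewrite abszN.
by rewrite ler_norml cos_geN1 cos_le1.
Qed.

(** The strict inequalities keep the unit neighbours of [(i, j)] on the plateau, where the tent has
    no increments. *)
Lemma sadj_tent_wave_near s x y N i j : unit_range s ->
  csym s x y = 0 -> ssym s x y = 0 -> (`|i| < N)%N -> (`|j| < N)%N ->
  sapply (sadj s) (tent_wave x y N) i j = 0.
Proof.
move=> /allP s1 c0 s0 iN jN; rewrite sadj_tent_wave// big_seq big1// => t /s1.
case: t => c [m1 m2] /= /andP[hm1 hm2].
by rewrite !tent_near ?subrr ?mul0r ?mulr0//; lia.
Qed.

(** Pairing the equation with the tent wave gives [s2] as the sum of [psi * g], where [g] vanishes
    on the box of radius [n] and has squared l2 norm at most [C]. Cauchy-Schwarz then yields mass at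
    least [s2 ^+ 2 / C] outside that box. *)
Lemma l2_tail_ge s psi (s2 x y : R) : unit_range s -> 0 < s2 ->
  csym s x y = 0 -> ssym s x y = 0 ->
  (forall i j, sapply s psi i j = if (i == 0) && (j == 0) then s2 else 0) ->
  exists2 e : R, 0 < e & forall n,
    box_sum n (fun i j => psi i j ^+ 2) + e <=
    box_sum (2 * n).+3 (fun i j => psi i j ^+ 2).
Proof.
move=> s1 s2_gt0 c0 s0 hpsi.
(* With [N = n + 1], the box of radius [2n + 3 = 2N + 1] has [(4n + 7)^2 <= (7N)^2] points, and [g]
   is at most [sweight s / N] at each. The added [1] makes [C] positive. *)
pose C := 49 * (sweight s + 1) ^+ 2.
have w0 : 0 <= sweight s by apply: sumr_ge0 => t _; exact: normr_ge0.
have C0 : 0 < C by rewrite /C mulr_gt0// exprn_gt0//; lra.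
exists (s2 ^+ 2 / C); first by rewrite divr_gt0// exprn_gt0.
move=> n; set N := n.+1.
set g := sapply (sadj s) (tent_wave x y N).
have hs2 : s2 = box_sum (2 * n).+3 (fun i j => psi i j * g i j).
  have -> : (2 * n).+3 = (2 * N).+1 by rewrite /N; lia.
  rewrite /g -sapply_adjoint//; last first.
    by move=> i j ij; rewrite /tent_wave tent_far ?mul0r.
  (* Only the origin contributes to the pairing, and there the tent wave equals [1]. *)
  rewrite (@box_trunc _ 0%N)//; last first.
    move=> i j ij; rewrite hpsi; case: ifP => [/andP[/eqP i0 /eqP j0]|].
      by move: ij; rewrite i0 j0.
    by rewrite mulr0.
  rewrite /box_sum /= !big_seq1 hpsi/= /tent_wave tent_near//.
  by rewrite /phase !mulr0 addr0 cos0 !mul1r.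
have g2 : box_sum (2 * n).+3 (fun i j => g i j ^+ 2) <= C.
  apply: (@le_trans _ _ (box_sum (2 * n).+3 (fun _ _ => (sweight s / N%:R) ^+ 2))).
    apply: ler_box => i j _ _.
    rewrite -[g i j ^+ 2]real_normK ?num_real// ler_sqr ?nnegrE ?divr_ge0 ?ler0n//.
    exact: sadj_tent_wave_le.
  rewrite box_cst -exprMn /C (_ : 49 = 7 ^+ 2); last by ring.
  rewrite -exprMn ler_sqr ?nnegrE ?mulr_ge0 ?invr_ge0 ?ler0n ?addr_ge0//.
  rewrite mulrA ler_pdivrMr ?ltr0n//.
  rewrite mulrAC [_ * sweight s]mulrC.
  have : ((2 * n).+3.*2.+1%:R : R) <= 7 * N%:R by rewrite -natrM ler_nat /N; lia.
  have : 0 <= N%:R :> R by [].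
  nra.
set S := fun k => box_sum k (fun i j => psi i j ^+ 2).
pose near (i j : int) := (`|i| <= n)%N && (`|j| <= n)%N.
have hS : box_sum (2 * n).+3 (fun i j => if near i j then psi i j ^+ 2 else 0) =
          S n.
  rewrite (@box_trunc _ n).
  - rewrite /S /box_sum; apply: eq_big_seq => i; rewrite mem_zball => iN.
    by apply: eq_big_seq => j; rewrite mem_zball => jN; rewrite /near iN jN.
  - by lia.
  - by move=> i j ij; rewrite /near ifF//; lia.
(* AM-GM on each term, with the weight that balances the bound on [g] *)
have key : 2 * s2 + C / s2 * S n <= C / s2 * S (2 * n).+3 + s2 / C * C.
  rewrite {1}hs2 -hS /S -!box_sumZ -box_sumD.
  apply: (@le_trans _ _ (box_sum (2 * n).+3
    (fun i j => C / s2 * psi i j ^+ 2 + s2 / C * g i j ^+ 2))); last first.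
    by rewrite box_sumD !box_sumZ lerD2l ler_wpM2l// divr_ge0// ltW.
  apply: ler_box => i j _ _; case: ifPn => [/andP[iN jN]|_].
    rewrite /g sadj_tent_wave_near// ?ltnS// mulr0 mulr0 expr0n/=; lra.
  set p := psi i j; set q := g i j; rewrite mulr0 addr0.
  rewrite -subr_ge0 (_ : _ - _ = s2 / C * (C / s2 * p - q) ^+ 2).
    by apply: mulr_ge0; [apply: divr_ge0; exact: ltW|exact: sqr_ge0].
  by field; rewrite !gt_eqF.
rewrite -/(S n) -/(S (2 * n).+3).
have : s2 <= C / s2 * (S (2 * n).+3 - S n).
  by move: key; rewrite divfK ?gt_eqF//; lra.
rewrite mulrAC ler_pdivlMr// -expr2 => h.
rewrite -lerBrDl ler_pdivrMr// mulrC; lra.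
Qed.

(** At a zero of the symbol, each passage from radius [n] to [2n + 3] would add at least [e] to the
    mass of [psi], and enough passages exceed [C]. *)
Lemma l2_response_symbol_neq0 s psi (s2 C x y : R) : unit_range s -> 0 < s2 ->
  (forall i j, sapply s psi i j = if (i == 0) && (j == 0) then s2 else 0) ->
  (forall n, box_sum n (fun i j => psi i j ^+ 2) <= C) ->
  0 < csym s x y ^+ 2 + ssym s x y ^+ 2.
Proof.
move=> s1 s2_gt0 hpsi hC.
rewrite lt0r addr_ge0 ?sqr_ge0// andbT; apply/negP => /eqP/eqP.
rewrite paddr_eq0 ?sqr_ge0// !sqrf_eq0 => /andP[/eqP c0 /eqP s0].
have [e e0 he] := l2_tail_ge s1 s2_gt0 c0 s0 hpsi.
have hm m : exists n, m%:R * e <= box_sum n (fun i j => psi i j ^+ 2).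
  elim: m => [|m [n IHm]].
    by exists 0%N; rewrite mul0r /box_sum !big_seq1 sqr_ge0.
  exists (2 * n).+3; apply: le_trans (he n).
  by rewrite -natr1 mulrDl mul1r lerD2r.
have [n] := hm (Num.truncn (C / e)).+1.
move/le_trans/(_ (hC n)); rewrite leNgt => /negP; apply.
by rewrite -ltr_pdivrMr// truncnS_gt.
Qed.

End symbol.

(** * Fourier coefficients on the frequency square *)

Section integrals.
Context {R : realType}.
Implicit Types (g : R * R -> R).

Local Notation I := (`[- (1 / 2), 1 / 2]%classic : set R).
Local Notation Q := (@freq_square R).
Local Notation mu2 := (lebesgue2 R).

Lemma measurable_freq_square :
  measurable (Q : set (measurableTypeR R * measurableTypeR R)).
Proof. by apply: measurableX; exact: measurable_itv. Qed.

Lemma lebesgue2_freq_square : mu2 Q = 1%E.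
Proof.
have e : @lebesgue_measure R I = 1%E.
  rewrite lebesgue_measure_itv /= lte_fin ifT; last by lra.
  by rewrite -EFinD; congr EFin; lra.
have h := @product_measure1E _ _ _ _ R (@lebesgue_measure R) (@lebesgue_measure R)
  I I (measurable_itv _) (measurable_itv _).
by apply: (etrans h); transitivity (1 * 1 : \bar R)%E;
  [congr (_ * _)%E; exact: e|rewrite mule1].
Qed.

Lemma sin_periodz (x : R) (j : int) : sin (x + 2 * pi * j%:~R) = sin x.
Proof.
have hn (n : nat) y : sin (y + 2 * pi * n%:R) = sin y :> R.
  rewrite -(periodicn (@sinD2pi R) n y); congr sin; congr +%R.
  by rewrite -[RHS]mulr_natr -[pi *+ 2]mulr_natl.
case: j => n; first exact: hn.
by rewrite NegzE intrN mulrN -(hn n.+1) subrK.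
Qed.

(** The interval holds whole periods, so the antiderivative agrees at both ends. The free phase [th]
    absorbs the other variable in double integrals. *)
Lemma integral_cos_freq (th : R) (j : int) : j != 0 ->
  (\int[lebesgue_measure]_(y in I) (cos (th + 2 * pi * y * j%:~R))%:E = 0)%E.
Proof.
move=> j0; set w : R := 2 * pi * j%:~R.
have w0 : w != 0.
  by rewrite /w !mulf_neq0 ?intr_eq0// ?gt_eqF ?pi_gt0.
pose F (y : R) : R := w^-1 * sin (th + w * y).
have dF (y : R) : is_derive y 1 F (cos (th + 2 * pi * y * j%:~R)).
  have h1 : is_derive y 1 (fun y : R => th + w * y) w.
    rewrite [X in is_derive _ _ X _](_ : _ = cst th \+ w \*: id)//.
    apply: is_derive_eq; by rewrite add0r /GRing.scale /= mulr1.
  have h2 := @is_derive1_comp _ (@sin R) (fun y : R => th + w * y) y _ _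
    (is_derive_sin _) h1.
  rewrite [X in is_derive _ _ X _](_ : _ =
    w^-1 \*: (@sin R \o (fun y : R => th + w * y)))//.
  apply: is_derive_eq; rewrite /GRing.scale /= mulrCA mulVf ?mulr1//.
  by congr (cos (th + _)); rewrite /w; ring.
have dvF (y : R) : derivable F y 1 by case: (dF y).
have cF : continuous F.
  by move=> y; apply: differentiable_continuous; exact/derivable1_diffP.
have cf : continuous (fun y : R => cos (th + 2 * pi * y * j%:~R) : R).
  move=> y; apply: continuous_comp; last exact: continuous_cos.
  apply: continuousD; first exact: cst_continuous.
  apply: continuousM; last exact: cst_continuous.
  by apply: continuousM; [exact: cst_continuous|exact: cvg_id].
rewrite (@continuous_FTC2 _ _ F).
- rewrite -EFinB /F -mulrBr.
  have -> : th + w * (1 / 2) = th + w * - (1 / 2) + 2 * pi * j%:~R.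
    by rewrite -/w; lra.
  by rewrite sin_periodz subrr mulr0.
- lra.
- exact: continuous_subspaceT.
- split; first by move=> y _.
  + by apply: cvg_at_right_filter; exact: cF.
  + by apply: cvg_at_left_filter; exact: cF.
- by move=> y _; rewrite derive1E; exact: (@derive_val _ _ _ _ _ _ _ (dF y)).
Qed.

Lemma bounded_integrable_freq g (K : R) :
  measurable_fun [set: measurableTypeR R * measurableTypeR R] (g : _ -> R) ->
  (forall z, Q z -> `|g z| <= K) ->
  mu2.-integrable Q (EFin \o g).
Proof.
move=> mg gK; apply: measurable_bounded_integrable.
- exact: measurable_freq_square.
- by rewrite [ltLHS]lebesgue2_freq_square ltry.
- exact: measurable_funTS.
- exists K; split; first exact: num_real.
  by move=> M KM z Qz; exact: le_trans (gK _ Qz) (ltW KM).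
Qed.

(** Both orders of integration are wanted: [Rintegral_fwave] makes the inner integral run over a
    variable of nonzero frequency. *)
Lemma integral_freq_fubini1 g : mu2.-integrable Q (EFin \o g) ->
  (\int[mu2]_(z in Q) (g z)%:E = \int[lebesgue_measure]_(x in I)
     \int[lebesgue_measure]_(y in I) (g (x, y))%:E)%E.
Proof.
move=> ig; rewrite integral_mkcond.
have ig' : mu2.-integrable setT ((EFin \o g) \_ Q).
  by apply/(integrable_mkcond _ _).1 => //; exact: measurable_freq_square.
have h := @integral12_prod_meas1 _ _ _ _ R
  (@lebesgue_measure R) (@lebesgue_measure R) _ ig'.
apply: (etrans (esym h)).
rewrite [RHS]integral_mkcond; apply: eq_integral => x _.
rewrite /fubini_F patchE; case: ifPn => xI.
  rewrite [RHS]integral_mkcond; apply: eq_integral => y _.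
  by rewrite !patchE in_setX xI.
apply: integral0_eq => y _; rewrite patchE in_setX.
by rewrite (negbTE xI).
Qed.

Lemma integral_freq_fubini2 g : mu2.-integrable Q (EFin \o g) ->
  (\int[mu2]_(z in Q) (g z)%:E = \int[lebesgue_measure]_(y in I)
     \int[lebesgue_measure]_(x in I) (g (x, y))%:E)%E.
Proof.
move=> ig; rewrite integral_mkcond.
have ig' : mu2.-integrable setT ((EFin \o g) \_ Q).
  by apply/(integrable_mkcond _ _).1 => //; exact: measurable_freq_square.
have h := @integral21_prod_meas1 _ _ _ _ R
  (@lebesgue_measure R) (@lebesgue_measure R) _ ig'.
apply: (etrans (esym h)).
rewrite [RHS]integral_mkcond; apply: eq_integral => y _.
rewrite /fubini_G patchE; case: ifPn => yI.
  rewrite [RHS]integral_mkcond; apply: eq_integral => x _.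
  by rewrite !patchE in_setX yI andbT.
apply: integral0_eq => x _; rewrite patchE in_setX.
by rewrite (negbTE yI) andbF.
Qed.

(* The phase [th] treats the cosine ([th = 0]) and sine ([th = - pi / 2])
   coefficients at once. *)
Definition fwave (th : R) (i j : int) (z : R * R) : R :=
  cos (th + phase (2 * pi * z.1) (2 * pi * z.2) i j).

Lemma measurable_phase (i j : int) :
  measurable_fun [set: measurableTypeR R * measurableTypeR R]
    ((fun z => phase (2 * pi * z.1) (2 * pi * z.2) i j) : _ -> R).
Proof.
apply: measurable_funD; apply: measurable_funM => //; apply: measurable_funM => //.
Qed.

Lemma measurable_fwave th i j :
  measurable_fun [set: measurableTypeR R * measurableTypeR R] (fwave th i j : _ -> R).
Proof.
have mc : measurable_fun [set: measurableTypeR R] (@cos R : _ -> measurableTypeR R).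
  by apply: (@continuous_measurable_fun R); exact: continuous_cos.
apply: (measurableT_comp mc).
by apply: measurable_funD => //; exact: measurable_phase.
Qed.

Lemma fwave_le1 th i j z : `|fwave th i j z| <= 1.
Proof. by rewrite ler_norml cos_geN1 cos_le1. Qed.

Lemma Rintegral_fwave th i j : \int[mu2]_(z in Q) fwave th i j z =
  if (i == 0) && (j == 0) then cos th else 0.
Proof.
have iw i' j' : mu2.-integrable Q (EFin \o fwave th i' j').
  by apply: bounded_integrable_freq (measurable_fwave _ _ _) _ => z _; exact: fwave_le1.
have [->|i0] /= := eqVneq i 0; last first.
  rewrite /Rintegral integral_freq_fubini2//= integral0_eq// => y _.
  have := integral_cos_freq (th + 2 * pi * y * j%:~R) i0.
  under eq_integral => x _ do rewrite -addrA [X in th + X]addrC.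
  by [].
have [->|j0] := eqVneq j 0.
  rewrite (@eq_Rintegral _ _ _ _ _ (cst (cos th))); last first.
    by move=> z _; rewrite /fwave /phase !mulr0 !addr0.
  rewrite Rintegral_cst; last exact: measurable_freq_square.
  by rewrite [X in fine X]lebesgue2_freq_square /= mulr1.
rewrite /Rintegral integral_freq_fubini1 // integral0_eq// => x _.
have := integral_cos_freq (th + 2 * pi * x * 0%:~R) j0.
by under eq_integral => y _ do rewrite -addrA.
Qed.

Lemma Rintegral_freq_sum (J : Type) (r : seq J) (F : J -> R * R -> R) :
  (forall t, mu2.-integrable Q (EFin \o F t)) ->
  \int[mu2]_(z in Q) (\sum_(t <- r) F t z) =
  \sum_(t <- r) \int[mu2]_(z in Q) F t z.
Proof.
move=> iF; have mQ := measurable_freq_square.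
elim: r => [|t r IHr].
  rewrite big_nil (@eq_Rintegral _ _ _ _ _ (cst 0)) ?Rintegral_cst ?mul0r//.
  by move=> z _; rewrite big_nil.
rewrite big_cons -IHr -RintegralD//.
  by under eq_Rintegral do rewrite big_cons.
have := @integrable_sum _ _ _ mu2 Q mQ J r xpredT
  (fun t => EFin \o F t) (fun t _ => iF t).
by under eq_fun do rewrite sumEFin.
Qed.

Lemma measurable_csym (s : seq (R * (int * int))) :
  measurable_fun [set: measurableTypeR R * measurableTypeR R]
    ((fun z => csym s (2 * pi * z.1) (2 * pi * z.2)) : _ -> R).
Proof.
apply: measurable_sum => t; apply: measurable_funM => //.
under eq_fun do rewrite -[phase _ _ _ _]add0r.
exact: measurable_fwave.
Qed.

(** * Fourier coefficients with a fixed phase *)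

Section coefficients.
Variables (s : seq (R * (int * int))) (th : R).
Hypothesis ssym0 : forall x y, ssym s x y = 0.

Definition fcoef g (i j : int) : R := \int[mu2]_(z in Q) (fwave th i j z * g z).

Lemma integrable_fwaveM g (K : R) i j :
  measurable_fun [set: measurableTypeR R * measurableTypeR R] (g : _ -> R) ->
  (forall z, Q z -> `|g z| <= K) ->
  mu2.-integrable Q (EFin \o (fun z => fwave th i j z * g z)).
Proof.
move=> mg gK; apply: (@bounded_integrable_freq _ K).
  by apply: measurable_funM => //; exact: measurable_fwave.
move=> z /gK gz; rewrite normrM -[leRHS]mul1r ler_pM//.
exact: fwave_le1.
Qed.

Lemma fcoef_le g (K : R) i j :
  measurable_fun [set: measurableTypeR R * measurableTypeR R] (g : _ -> R) ->
  (forall z, Q z -> `|g z| <= K) -> `|fcoef g i j| <= K.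
Proof.
move=> mg gK; have ig := integrable_fwaveM i j mg gK.
have mQ := measurable_freq_square.
apply: (le_trans (le_normr_Rintegral mQ ig)).
have -> : K = \int[mu2]_(z in Q) K.
  by rewrite Rintegral_cst// [X in fine X]lebesgue2_freq_square /= mulr1.
apply: le_Rintegral => //.
- exact: (integrable_norm ig).
- by apply: (@bounded_integrable_freq _ `|K|) => //.
- move=> z /gK gz; rewrite normrM -[leRHS]mul1r ler_pM//.
  exact: fwave_le1.
Qed.

(** Translations of the index act on the waves under the integral, so the stencil multiplies [g] by
    its symbol. A real symbol does not mix the phase [th] with the conjugate one. *)
Lemma sapply_fcoef g (K : R) i j :
  measurable_fun [set: measurableTypeR R * measurableTypeR R] (g : _ -> R) ->
  (forall z, Q z -> `|g z| <= K) ->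
  sapply s (fcoef g) i j =
  fcoef (fun z => csym s (2 * pi * z.1) (2 * pi * z.2) * g z) i j.
Proof.
move=> mg gK; have mQ := measurable_freq_square.
transitivity (\sum_(t <- s) \int[mu2]_(z in Q)
   (t.1 * (fwave th (i + t.2.1) (j + t.2.2) z * g z))).
  apply: eq_bigr => t _; rewrite RintegralZl//.
  exact: integrable_fwaveM mg gK.
rewrite -Rintegral_freq_sum; last first.
  move=> t; have := integrable_fwaveM (i + t.2.1) (j + t.2.2) mg gK.
  by move/(integrableZl mQ t.1).
apply: eq_Rintegral => z _.
have := sapply_cos s th (2 * pi * z.1) (2 * pi * z.2) i j.
rewrite ssym0 mulr0 subr0 mulrA -/(fwave _ _ _ _) => <-.
by rewrite /sapply mulr_suml; apply: eq_bigr => t _; rewrite mulrA.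
Qed.

End coefficients.

End integrals.

(** * Bounded solutions and the spectral representation *)

Section spectral.
Context {R : realType}.
Implicit Types (s : seq (R * (int * int))) (u : int -> int -> R).
Local Notation Q := (@freq_square R).

(** * Uniqueness of bounded solutions *)

Lemma bernoulli_ineq (d : R) n : 0 <= d -> 1 + n%:R * d <= (1 + d) ^+ n.
Proof.
move=> d0; elim: n => [|n IHn]; first by rewrite mul0r addr0 expr0.
rewrite exprS -natr1; have n0 : 0 <= n%:R :> R by [].
nra.
Qed.

(** Geometric growth beats quadratic growth. At index [3n], the cube of Bernoulli's inequality gives
    a cubic lower bound on the left side against a quadratic upper bound on the right. *)
Lemma expn_decay_eq0 (v K d : R) : 0 < d ->
  (forall n, v * (1 + d) ^+ n <= n.*2.+1%:R ^+ 2 * K) -> v <= 0.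
Proof.
move=> d0 hv; rewrite leNgt; apply/negP => v0.
have K0 : 0 < K.
  by have := hv 0%N; rewrite expr0 mulr1 expr1n mul1r; exact: lt_le_trans.
(* The cap at [1] ensures [(n + 1) e <= 1 + n d]. *)
pose e := Num.min 1 d; have e0 : 0 < e by rewrite lt_min ltr01.
have e1 : e <= 1 by rewrite ge_min lexx.
have ed : e <= d by rewrite ge_min lexx orbT.
(* This [n] contradicts [(n + 1) v e^3 <= 49 K], derived below; [49] is the square of the [7] in
   [6n + 1 <= 7 (n + 1)]. *)
have [n hn] : exists n : nat, 49 * K / (v * e ^+ 3) < n%:R.
  by exists (Num.truncn (49 * K / (v * e ^+ 3))).+1; exact: truncnS_gt.
rewrite ltr_pdivrMr ?mulr_gt0 ?exprn_gt0// in hn.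
have := hv (n * 3)%N; rewrite exprM.
have h1 : (n.+1%:R * e) ^+ 3 <= ((1 + d) ^+ n) ^+ 3.
  have n0 : 0 <= n%:R :> R by [].
  apply: lerXn2r; first by rewrite nnegrE mulr_ge0// ltW.
    by rewrite nnegrE exprn_ge0//; lra.
  apply: le_trans (bernoulli_ineq n (ltW d0)).
  rewrite -natr1; nra.
have h2 : (n * 3).*2.+1%:R <= 7 * n.+1%:R :> R by rewrite -natrM ler_nat; lia.
move=> h3.
have h4 : v * (n.+1%:R * e) ^+ 3 <= 49 * n.+1%:R ^+ 2 * K.
  apply: (le_trans (ler_wpM2l (ltW v0) h1)); apply: (le_trans h3).
  apply: (ler_wpM2r (ltW K0)).
  rewrite (_ : 49 * _ = (7 * n.+1%:R) ^+ 2); last by ring.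
  by apply: lerXn2r; rewrite ?nnegrE ?mulr_ge0.
have n1 : 0 < n.+1%:R :> R by rewrite ltr0n.
have h5 : n.+1%:R * (v * e ^+ 3) <= 49 * K.
  rewrite -(ler_pM2l (exprn_gt0 2 n1)).
  by move: h4; set N := n.+1%:R; lra.
move: hn; rewrite ltNge => /negP; apply; apply: le_trans h5.
by rewrite ler_wpM2r ?ler_nat// ltW// mulr_gt0// exprn_gt0.
Qed.

Lemma unit_range_shift s t i j n : unit_range s -> t \in s ->
  (n.+1 < `|i|)%N || (n.+1 < `|j|)%N ->
  (n < `|(i + t.2.1)%R|)%N || (n < `|(j + t.2.2)%R|)%N.
Proof. by move=> /allP /[apply]; case: t => c [m1 m2] /=; lia. Qed.

Lemma bounded_fixed_point_eq0 s u (K d : R) : unit_range s -> 0 < d ->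
  (forall x y, ssym s x y = 0) ->
  (forall z, Q z -> `|csym s (2 * pi * z.1) (2 * pi * z.2)| * (1 + d) <= 1) ->
  (forall i j, `|u i j| <= K) ->
  (forall i j, sapply s u i j = u i j) ->
  forall i j, u i j = 0.
Proof.
move=> s1 d0 ss0 cs uK fixu i0 j0.
(* The Fourier coefficients [b n] of the [n]-th power of the symbol form the convolution kernel of
   the [n]-th iterate of the stencil. *)
pose g n (z : R * R) : R := csym s (2 * pi * z.1) (2 * pi * z.2) ^+ n.
pose b n := fcoef 0 (g n).
have mg n : measurable_fun [set: measurableTypeR R * measurableTypeR R] (g n : _ -> R).
  by apply: measurable_funX; exact: measurable_csym.
have gd n z : Q z -> `|g n z| <= (1 + d) ^- n.
  move=> Qz; rewrite normrX -exprVn; apply: lerXn2r; rewrite ?nnegrE ?invr_ge0//.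
    by lra.
  by rewrite -[leRHS]mul1r ler_pdivlMr ?cs//; lra.
have bS n i j : b n.+1 i j = sapply s (b n) i j.
  rewrite (sapply_fcoef _ ss0 _ _ (mg n) (gd n)).
  by apply: eq_Rintegral => z _; rewrite /g exprS.
have b0 i j : b 0%N i j = if (i == 0) && (j == 0) then 1 else 0.
  rewrite -(@cos0 R) -Rintegral_fwave; apply: eq_Rintegral => z _.
  by rewrite /g expr0 mulr1.
(* Each application of the stencil enlarges the support by at most one. *)
have bsupp n i j : (n < `|i|)%N || (n < `|j|)%N -> b n i j = 0.
  elim: n i j => [|n IHn] i j ij.
    rewrite b0; case: ifP => // /andP[/eqP i1 /eqP j1].
    by move: ij; rewrite i1 j1.
  rewrite bS /sapply big_seq big1// => t ts.
  rewrite IHn ?mulr0//; exact: (unit_range_shift s1 ts ij).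
pose S N n i j := box_sum N (fun k l => b n k l * u (i - k) (j - l)).
(* Iterating the fixed-point equation writes [u] as its convolution with [b n]; [n < N] leaves room
   for unit shifts inside the box. *)
have SE N n : (n < N)%N -> forall i j, S N n i j = u i j.
  elim: n => [|n IHn] nN i j.
    rewrite /S (@box_trunc _ 0%N)//; last first.
      by move=> k l kl; rewrite bsupp ?mul0r.
    by rewrite /box_sum /= !big_seq1 b0 /= mul1r !subr0.
  transitivity (sapply s (S N n) i j); last first.
    rewrite -[RHS]fixu; apply: eq_sapply => *; apply: IHn; exact: ltnW.
  transitivity (\sum_(t <- s) box_sum N (fun k l =>
      t.1 * (b n (k + t.2.1) (l + t.2.2) * u (i - k) (j - l)))).
    rewrite -box_exchange; apply: eq_box => k l.
    by rewrite bS /sapply mulr_suml; apply: eq_bigr => t _; rewrite mulrA.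
  rewrite /sapply big_seq [RHS]big_seq; apply: eq_bigr => t ts.
  rewrite box_sumZ /S; congr *%R.
  have /andP[t1 t2] := allP s1 _ ts.
  rewrite -(@box_shift _ _ (fun k l =>
    b n k l * u (i + t.2.1 - k) (j + t.2.2 - l)) _ _ t1 t2).
    apply: eq_box => k l.
    by congr (_ * u _ _); rewrite opprD addrACA subrr addr0.
  by move=> k l kl; rewrite bsupp ?mul0r//; lia.
apply/eqP; rewrite -normr_le0.
apply: (@expn_decay_eq0 _ K d d0) => n.
rewrite -ler_pdivlMr; last by rewrite exprn_gt0//; lra.
(* Cut back to radius [n], the convolution has [(2n + 1)^2] terms, each at most [K / (1 + d)^n]. *)
rewrite -(SE n.+1 n)// /S (@box_trunc _ n)//; last first.
  by move=> k l kl; rewrite bsupp ?mul0r.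
rewrite (le_trans (ler_norm_box _ _))// -mulrA -box_cst.
apply: ler_box => k l _ _; rewrite normrM mulrC ler_pM//.
exact: fcoef_le (mg n) (gd n).
Qed.

Lemma csym_le_sweight s x y : `|csym s x y| <= sweight s.
Proof.
rewrite (le_trans (ler_norm_sum _ _ _))//; apply: ler_sum => t _.
by rewrite normrM ler_piMr// ler_norml cos_geN1 cos_le1.
Qed.

(** A kernel element is fixed by the identity minus the stencil divided by [M]. As [M] bounds the
    symbol, the new symbol lies in [[0, 1 - m / M]] on [Q], and [(1 - p)(1 + p) <= 1] gives the
    contraction condition with [d = m / M]. *)
Lemma bounded_kernel_eq0 s u (K m : R) : unit_range s -> 0 < m ->
  (forall x y, ssym s x y = 0) ->
  (forall z, Q z -> m <= csym s (2 * pi * z.1) (2 * pi * z.2)) ->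
  (forall i j, `|u i j| <= K) ->
  (forall i j, sapply s u i j = 0) ->
  forall i j, u i j = 0.
Proof.
move=> s1 m0 ss0 cs uK su0.
pose M := sweight s + m.
have w0 : 0 <= sweight s by apply: sumr_ge0.
have M0 : 0 < M by rewrite /M; lra.
pose s' := (1, (0, 0)) :: [seq (- (t.1 / M), t.2) | t <- s].
apply: (@bounded_fixed_point_eq0 s' u K (m / M)) => //.
- by rewrite /unit_range /= all_map; exact: s1.
- exact: divr_gt0.
- move=> x y; transitivity (- M^-1 * ssym s x y); last by rewrite ss0 mulr0.
  rewrite /ssym /s' big_cons big_map /phase /= !mulr0 addr0 sin0.
  rewrite mulr0 add0r mulr_sumr.
  by apply: eq_bigr => t _; rewrite /phase; ring.
- move=> z Qz; set x := 2 * pi * z.1; set y := 2 * pi * z.2.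
  have -> : csym s' x y = 1 - csym s x y / M.
    rewrite /csym /s' big_cons big_map /phase /= !mulr0 addr0 cos0 mulr1.
    rewrite mulr_suml -sumrN; congr +%R.
    by apply: eq_bigr => t _; rewrite /phase; ring.
  have c1 : m / M <= csym s x y / M by rewrite ler_pM2r ?invr_gt0// cs.
  have c2 : csym s x y / M <= 1.
    rewrite ler_pdivrMr// mul1r /M.
    by have := le_trans (ler_norm _) (csym_le_sweight s x y); lra.
  have mM : 0 < m / M by exact: divr_gt0.
  rewrite ger0_norm; last by lra.
  by move: c1 c2 mM; set p := m / M; set q := _ / M; nra.
- move=> i j; transitivity (u i j - M^-1 * sapply s u i j); last first.
    by rewrite su0 mulr0 subr0.
  rewrite [LHS]/sapply /s' big_cons big_map /= mul1r !addr0 -mulNr.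
  by congr +%R; rewrite /sapply mulr_sumr; apply: eq_bigr => t _; ring.
Qed.

(** * The squared modulus of a symbol and its reciprocal *)

Definition sym2 s x y : R := csym s x y ^+ 2 + ssym s x y ^+ 2.

Lemma csym_sadj s x y : csym (scomp s (sadj s)) x y = sym2 s x y.
Proof. by rewrite csym_comp csym_adj ssym_adj mulrN opprK -!expr2. Qed.

Lemma ssym_sadj s x y : ssym (scomp s (sadj s)) x y = 0.
Proof. by rewrite ssym_comp csym_adj ssym_adj mulrN [X in _ - X]mulrC subrr. Qed.

Lemma measurable_sym2 s :
  measurable_fun [set: measurableTypeR R * measurableTypeR R]
    ((fun z => sym2 s (2 * pi * z.1) (2 * pi * z.2)) : _ -> R).
Proof.
under eq_fun do rewrite -csym_sadj.
exact: measurable_csym.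
Qed.

Lemma measurable_inv_sym2 s (s2 : R) :
  measurable_fun [set: measurableTypeR R * measurableTypeR R]
    ((fun z => s2 / sym2 s (2 * pi * z.1) (2 * pi * z.2)) : _ -> R).
Proof.
apply: measurable_funM => //.
(* The inverse is treated as the real power of exponent [-1]; the two agree because [sym2] is
   nonnegative. *)
have mp : measurable_fun [set: measurableTypeR R]
    ((fun x => x `^ (-1)) : _ -> measurableTypeR R) by exact: measurable_powR.
rewrite [X in measurable_fun _ X](_ : _ =
    (fun x : R => x `^ (-1)) \o (fun z => sym2 s (2 * pi * z.1) (2 * pi * z.2))).
  exact: (measurableT_comp mp (measurable_sym2 s)).
by apply/funext => z /=; rewrite powR_inv1// addr_ge0 ?sqr_ge0.
Qed.

Lemma inv_sym2_le s (s2 m : R) z : 0 < m ->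
  m <= sym2 s (2 * pi * z.1) (2 * pi * z.2) ->
  `|s2 / sym2 s (2 * pi * z.1) (2 * pi * z.2)| <= `|s2| / m.
Proof.
move=> m0 mz; have z0 := lt_le_trans m0 mz.
by rewrite normrM normfV (gtr0_norm z0) ler_wpM2l// lef_pV2.
Qed.

Lemma sym2_min s : (forall x y, 0 < sym2 s x y) ->
  exists2 m : R, 0 < m &
    forall z, Q z -> m <= sym2 s (2 * pi * z.1) (2 * pi * z.2).
Proof.
move=> s0.
have cQ : compact Q by apply: compact_setX; exact: segment_compact.
have Q0 : Q !=set0.
  by exists (0, 0); split; rewrite /= in_itv /=; apply/andP; split; lra.
have cf : continuous (fun z : R * R => sym2 s (2 * pi * z.1) (2 * pi * z.2)).
  (* As the symbol of a composed stencil, the function is a finite sum of cosines. *)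
  rewrite (_ : (fun _ => _) = fun z : R * R =>
      csym (scomp s (sadj s)) (2 * pi * z.1) (2 * pi * z.2)); last first.
    by apply/funext => z; rewrite csym_sadj.
  apply: (@continuous_big R _ (+%R) 0 xpredT (@add_continuous R)) => t _ z.
  apply: continuousM; first exact: cst_continuous.
  apply: continuous_comp; last exact: continuous_cos.
  apply: continuousD.
    apply: continuousM; last exact: cst_continuous.
    by apply: continuousM; [exact: cst_continuous|exact: cvg_fst].
  apply: continuousM; last exact: cst_continuous.
  by apply: continuousM; [exact: cst_continuous|exact: cvg_snd].
have [z _ hz] := compact_EVT_min Q0 cQ (continuous_subspaceT cf).
exists (sym2 s (2 * pi * z.1) (2 * pi * z.2)) => [|t Qt]; first exact: s0.
by apply: hz; rewrite inE.
Qed.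

(** Both sides are bounded solutions of one equation, with right side [cos th * s2] at the origin
    and [0] elsewhere, so their difference lies in the trivial bounded kernel. *)
Lemma spectral_representation s gam (s2 K m th : R) :
  unit_range (scomp s (sadj s)) -> 0 < m ->
  (forall z, Q z -> m <= sym2 s (2 * pi * z.1) (2 * pi * z.2)) ->
  (forall i j, `|gam i j| <= K) ->
  (forall i j, sapply (scomp s (sadj s)) gam i j =
     if (i == 0) && (j == 0) then s2 else 0) ->
  forall i j,
    fcoef th (fun z => s2 / sym2 s (2 * pi * z.1) (2 * pi * z.2)) i j =
    cos th * gam i j.
Proof.
move=> s1 m0 hm gamK gamE i j.
set f := fun z : R * R => _.
have mf : measurable_fun [set: measurableTypeR R * measurableTypeR R] (f : _ -> R).
  exact: measurable_inv_sym2.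
have fK z : Q z -> `|f z| <= `|s2| / m by move=> Qz; apply: inv_sym2_le => //; exact: hm.
apply/eqP; rewrite -subr_eq0; apply/eqP.
apply: (@bounded_kernel_eq0 (scomp s (sadj s))
  (fun i j => fcoef th f i j - cos th * gam i j) (`|s2| / m + K) m) => //.
- exact: ssym_sadj.
- by move=> z Qz; rewrite csym_sadj hm.
- move=> k l; rewrite (le_trans (ler_normB _ _))// lerD//.
    exact: fcoef_le mf fK.
  rewrite normrM -[leRHS]mul1r ler_pM//.
  by rewrite ler_norml cos_geN1 cos_le1.
- move=> k l; rewrite sapplyB (sapply_fcoef _ (@ssym_sadj s) _ _ mf fK).
  rewrite [X in _ - X](_ : _ = cos th * sapply (scomp s (sadj s)) gam k l);
    last first.
    by rewrite /sapply mulr_sumr; apply: eq_bigr => t _; rewrite mulrCA.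
  rewrite gamE; set dlt := if _ then _ else _.
  (* Multiplication by the symbol cancels the denominator of the density and leaves the constant
     [s2]. *)
  transitivity (\int[lebesgue2 R]_(z in Q) (s2 * fwave th k l z) - cos th * dlt).
    congr (_ - _); apply: eq_Rintegral => z; rewrite inE => Qz.
    rewrite csym_sadj /f [sym2 _ _ _ * _]mulrC divfK; first by rewrite mulrC.
    by rewrite gt_eqF// (lt_le_trans m0)// hm.
  rewrite RintegralZl; [|exact: measurable_freq_square|]; last first.
    by apply: bounded_integrable_freq (measurable_fwave _ _ _) _ => z _; exact: fwave_le1.
  rewrite Rintegral_fwave /dlt; case: ifP => _; last by rewrite !mulr0 subrr.
  by rewrite mulrC subrr.
Qed.

End spectral.

(** * Covariances and the autoregressive field *)

Section covariance_form.
Context {d : measure_display} {T : measurableType d} {R : realType}.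
Variable P : probability T R.
Implicit Types U V W : T -> R.

Local Notation L2 := (Lfun P 2%:E).

Definition rcov U V : R := fine (covariance P U V).

Lemma Lfun2_Lfun1 U : U \in L2 -> U \in Lfun P 1%E.
Proof. by move=> U2; apply: Lfun_subset12 => //; exact: fin_num_measure. Qed.

Lemma covariance_L2_fin U V : U \in L2 -> V \in L2 ->
  covariance P U V \is a fin_num.
Proof.
move=> U2 V2; apply: covariance_fin_num; [exact: Lfun2_Lfun1..|].
exact: Lfun2_mul_Lfun1.
Qed.

Lemma rcovC U V : rcov U V = rcov V U.
Proof. by rewrite /rcov covarianceC. Qed.

Lemma rcovDl U V W : U \in L2 -> V \in L2 -> W \in L2 ->
  rcov (U \+ V) W = rcov U W + rcov V W.
Proof.
by move=> *; rewrite /rcov covarianceDl// fineD// covariance_L2_fin.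
Qed.

Lemma rcovZl (k : R) U V : U \in L2 -> V \in L2 ->
  rcov (k \o* U) V = k * rcov U V.
Proof.
move=> U2 V2; rewrite /rcov covarianceZl ?fineM ?covariance_L2_fin//.
- exact: Lfun2_Lfun1.
- exact: Lfun2_Lfun1.
- exact: Lfun2_mul_Lfun1.
Qed.

Lemma L2Z (k : R) U : U \in L2 -> k \o* U \in L2.
Proof. by move=> U2; apply: Lfun_scale => //; exact: ler1n. Qed.

Lemma L2D U V : U \in L2 -> V \in L2 -> U \+ V \in L2.
Proof. by move=> U2 V2; rewrite rpredD ?lee1n. Qed.

Lemma rcov_ge0 U : U \in L2 -> 0 <= rcov U U.
Proof. by move=> U2; rewrite fine_ge0// variance_ge0. Qed.

Lemma expectation_ae U V : U \in Lfun P 1%E -> V \in Lfun P 1%E ->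
  {ae P, forall w, U w = V w} -> 'E_P[U]%E = 'E_P[V]%E.
Proof.
move=> U1 V1 UV; rewrite unlock; apply: ae_eq_integral => //.
- by apply/measurable_EFinP; exact: (set_mem (sub_Lfun_mfun U1)).
- by apply/measurable_EFinP; exact: (set_mem (sub_Lfun_mfun V1)).
- by apply: filterS UV => w + _ => /= ->.
Qed.

Lemma rcov_ae U V W : U \in L2 -> V \in L2 -> W \in L2 ->
  {ae P, forall w, U w = V w} -> rcov U W = rcov V W.
Proof.
move=> U2 V2 W2 UV.
have [U1 V1] := (Lfun2_Lfun1 U2, Lfun2_Lfun1 V2); have W1 := Lfun2_Lfun1 W2.
have UW := Lfun2_mul_Lfun1 U2 W2; have VW := Lfun2_mul_Lfun1 V2 W2.
rewrite /rcov !covarianceE// (expectation_ae U1 V1 UV).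
rewrite (expectation_ae UW VW)//.
by apply: filterS UV => w /= uv; rewrite /GRing.mul /= uv.
Qed.

(** By induction on the list: removing from [U] its projection on [E k] keeps the other coefficients
    and lowers [s2 * rcov U U] by [q ^+ 2]. *)
Lemma bessel (I : eqType) (r : seq I) (E : I -> T -> R) U (s2 : R) :
  uniq r -> 0 < s2 -> U \in L2 -> (forall k, E k \in L2) ->
  (forall k l, rcov (E k) (E l) = if k == l then s2 else 0) ->
  \sum_(k <- r) rcov U (E k) ^+ 2 <= s2 * rcov U U.
Proof.
move=> ur s20 U2 E2 EE.
elim: r U U2 ur => [|k r IHr] U U2.
  by rewrite big_nil => _; rewrite mulr_ge0 ?rcov_ge0// ltW.
move=> /= /andP[kr ur]; rewrite big_cons.
set q := rcov U (E k).
pose U' := U \+ ((- (q / s2)) \o* E k).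
have U'2 : U' \in L2 by apply: L2D => //; exact: L2Z.
have U'E V : V \in L2 -> rcov U' V = rcov U V - q / s2 * rcov (E k) V.
  by move=> V2; rewrite rcovDl ?rcovZl ?mulNr//; exact: L2Z.
have hsum : \sum_(l <- r) rcov U' (E l) ^+ 2 = \sum_(l <- r) rcov U (E l) ^+ 2.
  apply: eq_big_seq => l lr; rewrite U'E// EE ifF ?mulr0 ?subr0//.
  by apply/negP => /eqP kl; rewrite kl lr in kr.
have hv : s2 * rcov U' U' = s2 * rcov U U - q ^+ 2.
  rewrite U'E// [rcov U U']rcovC [rcov (E k) U']rcovC !U'E//.
  rewrite EE eqxx [rcov (E k) U]rcovC -/q.
  by field; rewrite gt_eqF.
by have := IHr U' U'2 ur; rewrite hsum hv; lra.
Qed.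

Lemma rcov_le U V : U \in L2 -> V \in L2 ->
  `|rcov U V| <= (rcov U U + rcov V V) / 2.
Proof.
move=> U2 V2.
(* The variance of [U + k V] is nonnegative; [k = 1] and [k = -1] give the two bounds. *)
have h (k : R) : k ^+ 2 = 1 -> - (k * rcov U V) <= (rcov U U + rcov V V) / 2.
  move=> k2; have kV2 := L2Z k V2; have W2 := L2D U2 kV2.
  have := rcov_ge0 W2.
  rewrite rcovDl// [rcov U _]rcovC [rcov (_ \o* _) _]rcovC !rcovDl//.
  rewrite [rcov U (_ \o* _)]rcovC !rcovZl//  [rcov V (_ \o* _)]rcovC rcovZl//.
  rewrite [rcov V U]rcovC mulrA -expr2 k2; lra.
have := h 1 (expr1n _ _); have := h (- 1) (etrans (sqrrN _) (expr1n _ _)).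
by rewrite mulN1r mul1r ler_norml; lra.
Qed.

End covariance_form.

(** * The autoregressive equation in terms of covariances *)

Section autoregression.
Context {d : measure_display} {T : measurableType d} {R : realType}.
Variables (P : probability T R) (a b c s2 : R).
Variables (eps X : int -> int -> {RV P >-> R}).
Hypothesis s2_gt0 : 0 < s2.
Hypothesis eps_noise : white_noise s2 eps.
Hypothesis X_stationary : wide_sense_stationary X.
Hypothesis X_eq : forall i j : int, {ae P, forall w,
     X i j w = a * X (i - 1) j w + b * X i (j - 1) w
               + c * X (i - 1) (j - 1) w + eps i j w}.

Definition ar_stencil : seq (R * (int * int)) :=
  [:: (1, (0, 0)); (- a, (- 1, 0)); (- b, (0, - 1)); (- c, (- 1, - 1))].

Definition acov (i j : int) : R := rcov P (X i j) (X 0 0).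
Definition xcov (i j : int) : R := rcov P (X i j) (eps 0 0).

Let X2 i j : (X i j : T -> R) \in Lfun P 2%:E.
Proof. by case: X_stationary => + _ _; exact. Qed.

Let eps2 i j : (eps i j : T -> R) \in Lfun P 2%:E.
Proof. by case: eps_noise => + _ _ _; exact. Qed.

Lemma rcov_eps i j k l :
  rcov P (eps i j) (eps k l) = if (i, j) == (k, l) then s2 else 0.
Proof.
case: eps_noise => _ _ V cov0; case: eqP => [[-> ->]|/eqP ne].
  by have := V k l; rewrite /variance /rcov => ->.
by rewrite /rcov cov0.
Qed.

Lemma rcov_X i j k l : rcov P (X i j) (X k l) = acov (i - k) (j - l).
Proof.
case: X_stationary => _ _ st.
have := st i j (i - k) (j - l) (i - k) (j - l).
by rewrite !subKr !subrr /acov /rcov => ->.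
Qed.

Lemma sapply_ar (V : T -> R) i j : V \in Lfun P 2%:E ->
  sapply ar_stencil (fun k l => rcov P (X k l) V) i j = rcov P (eps i j) V.
Proof.
move=> V2.
pose Y := (a \o* X (i - 1) j \+ b \o* X i (j - 1)) \+
  (c \o* X (i - 1) (j - 1) \+ eps i j).
have Y2 : Y \in Lfun P 2%:E by do !apply: L2D; rewrite ?L2Z.
have := rcov_ae (X2 i j) Y2 V2; rewrite /Y.
rewrite !rcovDl ?L2D ?L2Z// !rcovZl// => XY.
rewrite /sapply /= !big_cons big_nil /= !addr0 XY; first ring.
by apply: filterS (X_eq i j) => w /= ->; ring.
Qed.

(** The noise is the stencil applied to [X]. In the second argument of the covariance its shifts act
    on the lag with opposite sign, hence the adjoint. *)
Lemma rcov_X_eps i j k l :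
  rcov P (X i j) (eps k l) = sapply (sadj ar_stencil) acov (i - k) (j - l).
Proof.
rewrite rcovC -sapply_ar// /sapply big_map; apply: eq_bigr => t _ /=.
by rewrite rcovC rcov_X !opprD !addrA.
Qed.

Lemma xcovE i j : xcov i j = sapply (sadj ar_stencil) acov i j.
Proof. by rewrite /xcov rcov_X_eps !subr0. Qed.

Lemma sapply_xcov i j :
  sapply ar_stencil xcov i j = if (i == 0) && (j == 0) then s2 else 0.
Proof. by rewrite sapply_ar// rcov_eps. Qed.

(** The adjoint turns [acov] into [xcov], which the stencil turns into the covariance of the
    noise. *)
Lemma sapply_acov i j : sapply (scomp ar_stencil (sadj ar_stencil)) acov i j =
  if (i == 0) && (j == 0) then s2 else 0.
Proof.
rewrite sapply_comp -sapply_xcov; apply: eq_sapply => k l.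
by rewrite xcovE.
Qed.

Lemma acov_le i j : `|acov i j| <= acov 0 0.
Proof.
by apply: le_trans (rcov_le (X2 _ _) (X2 _ _)) _; rewrite !rcov_X !subrr; lra.
Qed.

(** Bessel's inequality for [X 0 0] against the reflected noise: its covariance with
    [eps (- i) (- j)] is [xcov i j]. *)
Lemma xcov_l2 n : box_sum n (fun i j => xcov i j ^+ 2) <= s2 * acov 0 0.
Proof.
pose r := [seq (i, j) | i <- zball n, j <- zball n].
have ur : uniq r by apply: allpairs_uniq; rewrite ?zball_uniq// => [[? ?] [? ?]].
have EE (k l : int * int) :
    rcov P (eps (- k.1) (- k.2)) (eps (- l.1) (- l.2)) = if k == l then s2 else 0.
  case: k l => [k1 k2] [l1 l2]; rewrite rcov_eps /=.
  by rewrite !xpair_eqE !eqr_opp.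
have := bessel ur s2_gt0 (X2 0 0) (fun k => eps2 (- k.1) (- k.2)) EE.
rewrite big_allpairs -/(rcov _ _ _) => h; apply: le_trans h.
rewrite le_eqVlt; apply/orP; left; apply/eqP.
apply: eq_bigr => i _; apply: eq_bigr => j _ /=.
by rewrite rcov_X_eps !opprK !add0r xcovE.
Qed.

Lemma ar_sym2_gt0 x y : 0 < sym2 ar_stencil x y.
Proof. exact: l2_response_symbol_neq0 s2_gt0 sapply_xcov xcov_l2. Qed.

(** Taking expectations gives [(1 - a - b - c) m = 0], and the factor is the nonvanishing symbol at
    frequency zero. *)
Lemma ar_mean0 i j : 'E_P[X i j]%E = 0%E.
Proof.
have [_ Em _] := X_stationary; have [_ Ee _ _] := eps_noise.
have X1 k l := Lfun2_Lfun1 (X2 k l); have e1 k l := Lfun2_Lfun1 (eps2 k l).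
pose m := fine 'E_P[X 0 0]%E.
have EX k l : 'E_P[X k l]%E = m%:E.
  by rewrite (Em k l 0 0) fineK// expectation_fin_num.
pose Y := (a \o* X (i - 1) j \+ b \o* X i (j - 1)) \+
  (c \o* X (i - 1) (j - 1) \+ eps i j).
have Y2 : Y \in Lfun P 2%:E by do !apply: L2D; rewrite ?L2Z.
have : 'E_P[X i j]%E = 'E_P[Y]%E.
  apply: expectation_ae => //; first exact: Lfun2_Lfun1.
  by apply: filterS (X_eq i j) => w /= ->; rewrite /Y /=; ring.
have ZL k U : U \in Lfun P 2%:E -> (k \o* U \in Lfun P 1%E).
  by move=> U2; apply: Lfun2_Lfun1; exact: L2Z.
rewrite /Y expectationD; last 2 first.
- by apply: Lfun2_Lfun1; apply: L2D; exact: L2Z.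
- by apply: Lfun2_Lfun1; apply: L2D => //; exact: L2Z.
rewrite !expectationD ?ZL// !expectationZl// !EX Ee -!EFinM -!EFinD => -[hm].
have := ar_sym2_gt0 0 0.
rewrite /sym2 /csym /ssym /ar_stencil !big_cons !big_nil /phase /= !mul0r !addr0.
rewrite cos0 sin0 !mulr1 !mulr0 !addr0 expr0n /= addr0 => h.
have n0 : 1 + (- a + (- b - c)) != 0 by apply/eqP => n0; move: h; rewrite n0 expr0n ltxx.
by congr EFin; apply: (mulfI n0); rewrite mulr0; lra.
Qed.

Lemma ar_unit_range : unit_range (scomp ar_stencil (sadj ar_stencil)).
Proof. by []. Qed.

Lemma normc_sqr (z : R[i]) :
  (complex.Re `|z|) ^+ 2 = complex.Re z ^+ 2 + complex.Im z ^+ 2.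
Proof. by case: z => x y; rewrite normc_def /= sqr_sqrtr// addr_ge0 ?sqr_ge0. Qed.

(** The stencil shifts backwards, so its symbol is the conjugate of the displayed polynomial and has
    the same modulus. *)
Lemma ar_symbolE (nu : R * R) :
  (complex.Re `|1 - a%:C * expi (2 * pi * nu.1) - b%:C * expi (2 * pi * nu.2)
     - c%:C * expi (2 * pi * (nu.1 + nu.2))|) ^+ 2 =
  sym2 ar_stencil (2 * pi * nu.1) (2 * pi * nu.2).
Proof.
rewrite normc_sqr /expi /= /sym2 /csym /ssym /ar_stencil !big_cons !big_nil.
have m1 : (- 1)%:~R = - 1 :> R by rewrite intrN.
rewrite /phase /= !mulr0 !m1 !mulrN1 !addr0 !add0r.
have -> : - (2 * pi * nu.1) - 2 * pi * nu.2 = - (2 * pi * (nu.1 + nu.2)) by ring.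
rewrite !cosN !sinN cos0 sin0.
by ring.
Qed.

End autoregression.

Theorem corollary1 (d : measure_display) (T : measurableType d) (R : realType)
  (P : probability T R) (a b c sigma : R)
  (eps X : int -> int -> {RV P >-> R})
  (sigma_gt0 : 0 < sigma ^+ 2)
  (eps_noise : white_noise (sigma ^+ 2) eps)
  (X_stationary : wide_sense_stationary X)
  (X_eq : forall i j : int, {ae P, forall w,
     X i j w = a * X (i - 1) j w + b * X i (j - 1) w
               + c * X (i - 1) (j - 1) w + eps i j w}) :
  (forall i j : int, 'E_P[X i j]%E = 0%E) /\
  is_spectral_density X (fun nu : R * R =>
    sigma ^+ 2 /
    (complex.Re `|1 - a%:C * expi (2 * pi * nu.1) - b%:C * expi (2 * pi * nu.2)
       - c%:C * expi (2 * pi * (nu.1 + nu.2))|) ^+ 2).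
Proof.
split; first exact: (ar_mean0 sigma_gt0 eps_noise X_stationary X_eq).
have pos := ar_sym2_gt0 sigma_gt0 eps_noise X_stationary X_eq.
have [m m0 hm] := sym2_min pos.
under eq_fun do rewrite ar_symbolE.
split.
  apply: (bounded_integrable_freq (measurable_inv_sym2 _ _)) => z Qz.
  exact: inv_sym2_le m0 (hm z Qz).
move=> i j h1 h2.
have rep th := @spectral_representation _ _ _ _ _ _ th (ar_unit_range a b c) m0 hm
  (acov_le X_stationary) (sapply_acov eps_noise X_stationary X_eq) h1 h2.
have phaseE (nu : R * R) : 2 * pi * (h1%:~R * nu.1 + h2%:~R * nu.2) =
  phase (2 * pi * nu.1) (2 * pi * nu.2) h1 h2 by rewrite /phase; ring.
have -> : fine (covariance P (X i j) (X (i - h1) (j - h2))) = acov X h1 h2.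
  by rewrite -/(rcov _ _ _) (rcov_X X_stationary) !subKr.
rewrite /Cintegral; apply/eqP; rewrite eq_complex /=; apply/andP; split; apply/eqP.
  (* Phase [0] gives the real part. *)
  have := rep 0; rewrite cos0 mul1r => <-.
  apply: eq_Rintegral => z _.
  by rewrite /expi phaseE /= mulr0 subr0 /fwave add0r.
(* Since [cos (t - pi / 2) = sin t], this phase gives the imaginary part, which vanishes because
   [cos th = 0]. *)
have := rep (- (pi / 2)); rewrite cosN cos_pihalf mul0r => rep0.
apply: (etrans (esym rep0)).
apply: eq_Rintegral => z _.
rewrite /expi phaseE /= mulr0 add0r /fwave addrC.
by rewrite cosD cosN sinN cos_pihalf sin_pihalf; ring.
Qed.
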